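(* Fix $d\ge1$. Let $D\subset\mathbb{R}^d$ be a region of finite positive volume and let $\mathbf{p}_1,\dots,\mathbf{p}_n$ be independent points uniformly distributed on $D$. Run algorithm Peeling using algorithm Naive (described in the context) on $(\mathbf{p}_1,\dots,\mathbf{p}_n)$, and let $K$ be the number of maximal layers. Then the expected running time (number of comparisons) of the algorithm, conditioned on $K$, is $O\big(n^2\log(K+1)\big)$.
   Context: For $\mathbf{p},\mathbf{q}\in\mathbb{R}^d$, $\mathbf{q}\prec\mathbf{p}$ ($\mathbf{p}$ dominates $\mathbf{q}$) means all coordinates of $\mathbf{p}-\mathbf{q}$ are nonnegative and $\mathbf{p}\ne\mathbf{q}$; $\mathbf{Max}(S)$ is the set of points of $S$ not dominated by any point of $S$. The maximal layers of $\mathbf{p}=\{\mathbf{p}_1,\dots,\mathbf{p}_n\}$ are $\mathbf{L}_1=\mathbf{Max}(\mathbf{p})$ and $\mathbf{L}_k=\mathbf{Max}(\mathbf{p}\setminus\bigcup_{i<k}\mathbf{L}_i)$ for $k\ge2$, continuing until no point is left; $K$ is the number of nonempty layers. Algorithm Naive, on input $(\mathbf{q}_1,\dots,\mathbf{q}_m)$: for each $i=1,\dots,m$, scan $j=1,\dots,m$ and stop the scan as soon as $j\ne i$ and $\mathbf{q}_i\prec\mathbf{q}_j$; if the scan reaches the end without stopping, output $\mathbf{q}_i$ as a maximum. Algorithm Peeling: set $\mathbf{q}:=(\mathbf{p}_1,\dots,\mathbf{p}_n)$; while $\mathbf{q}$ is nonempty, compute the next layer $\mathbf{L}_k$ as the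 output of Naive on $\mathbf{q}$ and remove $\mathbf{L}_k$ from $\mathbf{q}$. *)

(* Defs.v *)
From HB Require Import structures.
From mathcomp Require Import all_boot all_order all_algebra.
From mathcomp Require Import all_classical all_reals all_analysis.

Set Implicit Arguments.
Unset Strict Implicit.
Unset Printing Implicit Defensive.

Import Order.TTheory GRing.Theory Num.Theory.

Local Open Scope classical_set_scope.
Local Open Scope ring_scope.

(* Points of R^d are d-tuples; the measurable sets of d.-tuple R (for the
   product sigma-algebra) are the Borel sets of R^d. *)

Definition cons_pair (T : Type) (n : nat) (x : T * n.-tuple T) :
    n.+1.-tuple T := [tuple of x.1 :: x.2].

Definition uncons (T : Type) (n : nat) (t : n.+1.-tuple T) : T * n.-tuple T :=
  (thead t, [tuple of behead t]).

Lemma cons_pairK (T : Type) (n : nat) : cancel (@cons_pair T n) (@uncons T n).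
Proof.
by case=> x t; congr (_, _); apply: val_inj.
Qed.

Section tuple_measure_step.
Context {disp : measure_display} {T : measurableType disp} {R : realType}.
Variables (m : {sigma_finite_measure set T -> \bar R}) (n : nat)
  (mu : {sigma_finite_measure set (n.-tuple T) -> \bar R}).

Definition tuple_measure_step : set (n.+1.-tuple T) -> \bar R :=
  pushforward (m \x mu)%E (@cons_pair T n).

Let measurable_cons_pair (A : set (n.+1.-tuple T)) :
  measurable A -> measurable (@cons_pair T n @^-1` A).
Proof.
move=> mA; rewrite -[X in measurable X]setTI.
have : measurable_fun [set: T * n.-tuple T] (@cons_pair T n).
  exact: measurable_cons.
by apply.
Qed.

Let measurable_uncons (A : set (T * n.-tuple T)) :
  measurable A -> measurable (@uncons T n @^-1` A).
Proof.
move=> mA; rewrite -[X in measurable X]setTI.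
have : measurable_fun [set: n.+1.-tuple T] (@uncons T n).
  apply/measurable_fun_pairP; split; first exact: measurable_tnth.
  exact: measurable_behead.
by apply.
Qed.

Let tuple_measure_step0 : tuple_measure_step set0 = 0%E.
Proof. by rewrite /tuple_measure_step /pushforward preimage_set0 measure0. Qed.

Let tuple_measure_step_ge0 A : (0 <= tuple_measure_step A)%E.
Proof. by rewrite /tuple_measure_step /pushforward measure_ge0. Qed.

Let tuple_measure_step_sigma_additive : semi_sigma_additive tuple_measure_step.
Proof.
move=> F mF tF mUF; rewrite /tuple_measure_step /pushforward preimage_bigcup.
apply: measure_semi_sigma_additive.
- by move=> k; exact: measurable_cons_pair.
- apply/trivIsetP => /= i j _ _ ij; rewrite -preimage_setI.
  by move/trivIsetP : tF => /(_ _ _ _ _ ij) ->//; rewrite preimage_set0.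
- by rewrite -preimage_bigcup; exact: measurable_cons_pair.
Qed.

HB.instance Definition _ := isMeasure.Build _ _ _ tuple_measure_step
  tuple_measure_step0 tuple_measure_step_ge0 tuple_measure_step_sigma_additive.

Let tuple_measure_step_sigma_finite : sigma_finite setT tuple_measure_step.
Proof.
have /sigma_finiteP[F [TF ndF Foo]] := sigma_finiteT m.
have /sigma_finiteP[G [TG ndG Goo]] := sigma_finiteT mu.
exists (fun k => @uncons T n @^-1` (F k `*` G k)).
  apply/esym; rewrite -subTset => t _.
  have [i _ Fi] : (\bigcup_i F i) (uncons t).1 by rewrite -TF.
  have [j _ Gj] : (\bigcup_i G i) (uncons t).2 by rewrite -TG.
  exists (maxn i j) => //; split.
  - by move: Fi; exact/subsetPset/ndF/leq_maxl.
  - by move: Gj; exact/subsetPset/ndG/leq_maxr.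
move=> k; have [mF Fk] := Foo k; have [mG Gk] := Goo k; split.
  by apply: measurable_uncons; exact: measurableX.
rewrite /tuple_measure_step /pushforward -comp_preimage.
rewrite (_ : _ \o _ = id) ?preimage_id; last first.
  by apply/funext => x; exact: cons_pairK.
by rewrite product_measure1E// lte_mul_pinfty// ge0_fin_numE.
Qed.

HB.instance Definition _ := Measure_isSigmaFinite.Build _ _ _
  tuple_measure_step tuple_measure_step_sigma_finite.

End tuple_measure_step.

Fixpoint tuple_measure {disp : measure_display} {T : measurableType disp}
    {R : realType} (m : {sigma_finite_measure set T -> \bar R}) (n : nat) :
    {sigma_finite_measure set (n.-tuple T) -> \bar R} :=
  match n with
  | 0 => dirac [tuple]
  | n'.+1 => tuple_measure_step m (tuple_measure m n')
  end.

(* Lebesgue measure on R^d. measurableTypeR R and R carry the same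
   sigma-algebra, under different measure displays. *)
Definition volume {R : realType} {d : nat} : set (d.-tuple R) -> \bar R :=
  @tuple_measure _ (measurableTypeR R) R (@lebesgue_measure R) d.

Section probability.
Context {disp : measure_display} {Omega : measurableType disp} {R : realType}.
Variable P : probability Omega R.

Definition uniform_on (d : nat) (D : set (d.-tuple R))
    (X : {RV P >-> d.-tuple R}) : Prop :=
  forall A, measurable A ->
    distribution P X A = (volume (A `&` D) / volume D)%E.

Definition mutually_independent (disp' : measure_display)
    (T : measurableType disp') (n : nat) (X : 'I_n -> {RV P >-> T}) : Prop :=
  forall (J : {set 'I_n}) (A : 'I_n -> set T),
    (forall i, measurable (A i)) ->
    P (\bigcap_(i in [set i | i \in J]) (X i @^-1` A i)) =
    (\prod_(i in J) P (X i @^-1` A i))%E.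

(* E[Y | E], for an event E of positive probability. *)
Definition cond_expectation (Y : Omega -> R) (E : set Omega) : \bar R :=
  ((\int[P]_(w in E) (Y w)%:E) / P E)%E.

End probability.

Section dominance.
Context {R : realType} {d : nat}.
Implicit Types p q : d.-tuple R.

Definition dominated q p : bool :=
  [forall i, 0 <= tnth p i - tnth q i] && (p != q).

(* Finite sets of points are given by sequences enumerating them. *)
Definition Max (S : seq (d.-tuple R)) : seq (d.-tuple R) :=
  [seq q <- S | ~~ has (dominated q) S].

(* [:: L_1; ...; L_k] *)
Fixpoint layers (S : seq (d.-tuple R)) (k : nat) : seq (seq (d.-tuple R)) :=
  if k is k'.+1 then
    let Ls := layers S k' in
    rcons Ls (Max [seq q <- S | q \notin flatten Ls])
  else [::].

(* Every nonempty layer removes at least one point, so that L_k is empty for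
   k > size S, and counting among the first size S layers loses nothing. *)
Definition num_layers (S : seq (d.-tuple R)) : nat :=
  count (fun L => L != [::]) (layers S (size S)).

(* The scan for the point qi of index i, where s is the part of the
   input that remains to be scanned and j is the index of its head. Returns
   whether the scan reaches the end, and the number of comparisons made, a
   comparison being a test of dominance between qi and qj for j != i. *)
Fixpoint scan (i : nat) qi (j : nat) (s : seq (d.-tuple R)) : bool * nat :=
  if s is qj :: s' then
    if j == i then scan i qi j.+1 s'
    else if dominated qi qj then (false, 1%N)
    else let: (b, c) := scan i qi j.+1 s' in (b, c.+1)
  else (true, 0%N).

(* Output, and total number of comparisons. *)
Definition naive (q : seq (d.-tuple R)) : seq (d.-tuple R) * nat :=
  let run (i : 'I_(size q)) := scan i (tnth (in_tuple q) i) 0 q in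
  ([seq tnth (in_tuple q) i | i <- enum 'I_(size q) & (run i).1],
   (\sum_i (run i).2)%N).

(* The while loop, run for at most fuel iterations. *)
Fixpoint peeling_loop (fuel : nat) (q : seq (d.-tuple R)) :
    seq (seq (d.-tuple R)) * nat :=
  if fuel is fuel'.+1 then
    if q is [::] then ([::], 0%N)
    else
      let: (L, c) := naive q in
      let: (Ls, c') := peeling_loop fuel' [seq x <- q | x \notin L] in
      (L :: Ls, (c + c')%N)
  else ([::], 0%N).

(* The fuel is never exhausted before q is empty: each iteration on a nonempty
   q removes at least one point. *)
Definition peeling (p : seq (d.-tuple R)) : seq (seq (d.-tuple R)) * nat :=
  peeling_loop (size p) p.

Definition peeling_comparisons (p : seq (d.-tuple R)) : nat := (peeling p).2.

End dominance.

(* Main.v *)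
From HB Require Import structures.
Require Import Defs.
From mathcomp Require Import all_boot all_order all_algebra all_fingroup.
From mathcomp Require Import all_classical all_reals all_analysis.
From mathcomp Require Import measurable_realfun zify ring lra.

Import Order.TTheory GRing.Theory Num.Theory.
Local Open Scope classical_set_scope.
Local Open Scope ring_scope.

(* The run of Peeling is governed by the dominance relation between indices.
   The points are exchangeable, so relabelling them by a permutation does not
   change the law of that relation, and it does not change K; hence the cost may
   be averaged over all orders of the input. In a random order, the scan for a
   in a round where g of the points left dominate a inspects a given point b
   only if b comes first among b and these g points, which has probability at
   most 1 / max(1, g). A point that survives up to round D has at least D - r
   dominators left in round r, so that a contributes at most n times
   1 + (1 + 1/2 + ... + 1/(K - 1)) comparisons, which is O(n log (K + 1)).
   Repeated points are harmless, since a point never dominates its copies. *)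

(** * Peeling on sequences of points: its cost and its layers *)

Section peeling_sequences.
Context {R : realType} {d : nat}.
Implicit Types (x y : d.-tuple R) (s q : seq (d.-tuple R)).

Lemma dominated_irr : irreflexive (@dominated R d).
Proof. by move=> x; rewrite /dominated eqxx andbF. Qed.

(** One strict coordinate in place of [x != y] makes transitivity and measurability easy to read
    off. *)
Lemma dominatedP x y :
  reflect ((forall i, tnth x i <= tnth y i) /\ exists i, tnth x i < tnth y i)
    (dominated x y).
Proof.
apply: (iffP andP) => -[].
  move=> /forallP xy yx; have {}xy i : tnth x i <= tnth y i.
    by rewrite -subr_ge0.
  split=> //; apply/existsP; rewrite -[X in is_true X]negbK negb_exists.
  apply/forallP => /= xyN; move/negP: yx; apply; apply/eqP/eq_from_tnth => i.
  by apply/le_anti; rewrite xy andbT leNgt.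
move=> xy [i xyi]; split; first by apply/forallP => j; rewrite subr_ge0.
by apply/eqP => yx; rewrite yx ltxx in xyi.
Qed.

Lemma dominated_trans : transitive (@dominated R d).
Proof.
move=> y x z /dominatedP[xy [i xyi]] /dominatedP[yz _]; apply/dominatedP.
by split=> [j|]; [exact: le_trans (xy j) (yz j)|exists i; exact: lt_le_trans (yz i)].
Qed.

Definition peel q := [seq x <- q | has (dominated x) q].

(** The position, counted from 1, of the first dominator of [x]. When there is none, [find] returns
    [size q], whence the cap. *)
Definition scan_bound x q : nat := minn (find (dominated x) q).+1 (size q).

(** The hypothesis says that the skipped entry does not dominate [x], so skipping it leaves the
    outcome unchanged and can only save a comparison. *)
Lemma scanP i x j s :
    (forall l, (j + l)%N = i -> ~~ dominated x (nth x s l)) ->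
  (scan i x j s).1 = ~~ has (dominated x) s /\
  ((scan i x j s).2 <= scan_bound x s)%N.
Proof.
rewrite /scan_bound; elim: s j => //= y s IHs j xN.
have {IHs} [|IH1 IH2] := IHs j.+1; first by move=> l; rewrite addSnnS => /xN.
case: eqP => [ji|_].
  have := xN 0%N; rewrite addn0 /= => /(_ ji) /negbTE ->.
  by split=> //; apply: leq_trans IH2 _; rewrite minnSS leqW.
case: ifP => [_|_ /=]; first by rewrite leq_min.
case: (scan _ _ _ _) IH1 IH2 => b c /= -> cs.
by split=> //; rewrite minnSS ltnS.
Qed.

Lemma scan_naive q (i : 'I_(size q)) (x := tnth (in_tuple q) i) :
  (scan i x 0 q).1 = ~~ has (dominated x) q /\
  ((scan i x 0 q).2 <= scan_bound x q)%N.
Proof.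
apply: scanP => l; rewrite add0n => ->.
by rewrite [X in dominated X](tnth_nth x) dominated_irr.
Qed.

Lemma mem_naive q x :
  x \in (naive q).1 = (x \in q) && ~~ has (dominated x) q.
Proof.
have run (i : 'I_(size q)) : (scan i (tnth (in_tuple q) i) 0 q).1 =
    ~~ has (dominated (tnth (in_tuple q) i)) q.
  exact: (scan_naive q i).1.
apply/mapP/andP => [[i]|[/(nthP x)[i iq <-] xN]].
  by rewrite mem_filter run => /andP[iN _] ->; rewrite mem_tnth.
exists (Ordinal iq); last by rewrite (tnth_nth x).
by rewrite mem_filter run mem_enum andbT (tnth_nth x).
Qed.

Lemma peel_naive q : [seq x <- q | x \notin (naive q).1] = peel q.
Proof.
by apply: eq_in_filter => x xq; rewrite mem_naive xq /= negbK.
Qed.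

Lemma naive_cost q : ((naive q).2 <= \sum_(x <- q) scan_bound x q)%N.
Proof.
rewrite [X in (_ <= X)%N]big_tnth; apply: leq_sum => i _.
exact: (scan_naive q i).2.
Qed.

Lemma peeling_loop_cost k q :
  (peeling_loop k q).2 = (\sum_(r < k) (naive (iter r peel q)).2)%N.
Proof.
elim: k q => [|k IHk] q; first by rewrite big_ord0.
case: q => [|x q].
  (* The loop stops on an empty sequence while the sum runs on; the empty sequence is fixed by
     [peel] and costs nothing. *)
  have naive0 : (naive ([::] : seq (d.-tuple R))).2 = 0%N.
    by apply: big1 => -[].
  by rewrite big1 // => i _; rewrite iter_fix.
rewrite big_ord_recl.
under eq_bigr do rewrite /= -iterS iterSr.
rewrite -peel_naive -IHk /peeling_loop -/peeling_loop.
by case: (naive _) => L c /=; case: (peeling_loop _ _).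
Qed.

Lemma Max_compl q : [seq x <- q | x \notin Max q] = peel q.
Proof.
by apply: eq_in_filter => x xq; rewrite mem_filter xq andbT negbK.
Qed.

(** The two claims need each other: the next layer is [Max] of what is left, and removing that layer
    is one [peel]. *)
Lemma layersE q k :
  layers q k = [seq Max (iter r peel q) | r <- iota 0 k] /\
  [seq x <- q | x \notin flatten (layers q k)] = iter k peel q.
Proof.
elim: k => [|k [IH1 IH2]]; first by split=> //=; rewrite filter_predT.
have E : layers q k.+1 = rcons (layers q k) (Max (iter k peel q)).
  by rewrite /= IH2.
split; first by rewrite E IH1 -cats1 -addn1 iotaD map_cat.
rewrite E -cats1 flatten_cat /= cats0 -[in RHS]Max_compl -IH2 -filter_predI.
by apply: eq_filter => x /=; rewrite mem_cat negb_or andbC.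
Qed.

Lemma num_layersE q :
  num_layers q = (\sum_(r < size q) (Max (iter r peel q) != [::]))%N.
Proof.
rewrite /num_layers (layersE q _).1 count_map -sumn_count sumnE big_map.
by rewrite -[X in iota 0 X]subn0 big_mkord.
Qed.

End peeling_sequences.

(** * Peeling read off from a relation on indices *)

Section dominance_relation.
Local Open Scope set_scope.
Context {n : nat}.
Implicit Types (e : {ffun 'I_n * 'I_n -> bool}) (s : {perm 'I_n}).
Implicit Types (i j a b c : 'I_n) (A B : {set 'I_n}).

(** The indices left before round [r], rounds being counted from 0; [e (i, j)] stands for point [i]
    being dominated by point [j]. *)
Definition alive e r : {set 'I_n} :=
  iter r (fun A => [set i in A | [exists j in A, e (i, j)]]) [set: 'I_n].

Definition tops e A : {set 'I_n} :=
  [set i in A | ~~ [exists j in A, e (i, j)]].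

Definition height e : nat := (\sum_(r < n) (tops e (alive e r) != finset.set0))%N.

(** The condition for the scan for [a] to reach [b]. The inequality is weak because the first
    dominator is itself inspected. *)
Definition precedes s b e A a : bool :=
  [forall c in A, e (a, c) ==> (s b <= s c)%N].

(* Bounds the number of comparisons when the points come in the order of their
   ranks under s. *)
Definition work s e : nat :=
  (\sum_(r < n) \sum_(a in alive e r) \sum_(b in alive e r)
     precedes s b e (alive e r) a)%N.

Definition relabel s e : {ffun 'I_n * 'I_n -> bool} :=
  [ffun p => e (s p.1, s p.2)].

Lemma aliveS e r i :
  (i \in alive e r.+1) = (i \in alive e r) && [exists j in alive e r, e (i, j)].
Proof. by rewrite /alive iterS inE. Qed.

Lemma exists_perm s (P : pred 'I_n) : [exists j, P (s j)] = [exists j, P j].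
Proof.
apply/existsP/existsP => -[j Pj]; first by exists (s j).
by exists (s^-1%g j); rewrite permKV.
Qed.

Lemma forall_perm s (P : pred 'I_n) : [forall j, P (s j)] = [forall j, P j].
Proof.
apply/fintype.forallP/fintype.forallP => P_all j; last exact: P_all.
by rewrite -[j](permKV s).
Qed.

Lemma alive_relabel s e r i : (i \in alive (relabel s e) r) = (s i \in alive e r).
Proof.
elim: r i => [|r IHr] i; first by rewrite !inE.
rewrite !aliveS IHr -[in RHS](exists_perm s); congr andb.
by apply: eq_existsb => j; rewrite IHr ffunE.
Qed.

Lemma height_relabel s e : height (relabel s e) = height e.
Proof.
have topsE r i : (i \in tops (relabel s e) (alive (relabel s e) r)) =
    (s i \in tops e (alive e r)).
  rewrite !inE alive_relabel -[in RHS](exists_perm s); congr (_ && ~~ _).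
  by apply: eq_existsb => j; rewrite alive_relabel ffunE.
apply: eq_bigr => r _; congr nat_of_bool; apply/set0Pn/set0Pn => -[i].
  by rewrite topsE; exists (s i).
by rewrite -[i](permKV s) -topsE; exists (s^-1%g i).
Qed.

(** Renaming the points amounts to changing their order: substituting [s a], [s b], [s c] for the
    indices turns their ranks into those under the inverse of [s]. *)
Lemma work_relabel s e : work 1 (relabel s e) = work s^-1 e.
Proof.
apply: eq_bigr => r _.
rewrite [RHS](reindex_inj (@perm_inj _ s)); apply: eq_big => [a|a _].
  exact: alive_relabel.
rewrite [RHS](reindex_inj (@perm_inj _ s)); apply: eq_big => [b|b _].
  exact: alive_relabel.
congr nat_of_bool; rewrite /precedes -[in RHS](forall_perm s).
by apply: eq_forallb => c; rewrite alive_relabel ffunE /= !perm1 !permK.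
Qed.

(* The sets of permutations that are minimal on B at a given point of B are
   pairwise disjoint, and composing with transpositions shows that they all have
   the same size. *)
Lemma card_perm_argmin B b : b \in B ->
  (#|[set s : {perm 'I_n} | [forall c in B, (s b <= s c)%N]]| * #|B| <= n`!)%N.
Proof.
pose M b := [set s : {perm 'I_n} | [forall c in B, (s b <= s c)%N]].
have sameM a c : a \in B -> c \in B -> (#|M a| <= #|M c|)%N.
  move=> aB cB; rewrite -(card_imset _ (mulgI (tperm a c))).
  apply/subset_leq_card/fintype.subsetP => _ /imsetP[s + ->]; rewrite !inE.
  move=> /forall_inP sa; apply/forall_inP => x xB; rewrite !permM tpermR.
  by apply: sa; case: tpermP => // ->.
move=> bB; rewrite mulnC -sum_nat_const.
apply: (@leq_trans (\sum_(c in B) #|M c|)); first by apply: leq_sum => c; exact: sameM.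
under eq_bigr do rewrite -sum1_card big_mkcond /=.
rewrite exchange_big -[X in (_ <= X)%N]card_Sn -sum1_card /=; apply: leq_sum => s _.
rewrite -big_mkcondr sum1dep_card; apply/card_le1_eqP => c c'.
rewrite !inE => /andP[cB /forall_inP cmin] /andP[c'B /forall_inP c'min].
apply: (@perm_inj _ s); apply/val_inj/eqP.
by rewrite eqn_leq cmin ?c'min.
Qed.

(** Bounds the probability of a given inspection in a random order when [s] dominators are left;
    with none the scan never stops early, and the weight is 1. *)
Definition harm_weight {R : realType} (s : nat) : R := (maxn 1 s)%:R^-1.

(** * Averaging the work over all orders, for a strict partial order *)

Section strict_order.
Variable e : {ffun 'I_n * 'I_n -> bool}.
Hypothesis e_irr : forall i, ~~ e (i, i).
Hypothesis e_trans : forall j i k, e (i, j) -> e (j, k) -> e (i, k).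

Definition above A a : {set 'I_n} := [set c in A | e (a, c)].

Lemma alive_anti r k : alive e (r + k) \subset alive e r.
Proof.
elim: k => [|k IHk]; first by rewrite addn0.
apply/fintype.subsetP => i; rewrite addnS aliveS => /andP[+ _].
exact/fintype.subsetP.
Qed.

(** Survival of one more round gives a dominator [j] that is alive in round [r + k]. The dominators
    of [j] dominate [a] by transitivity, and [j] is one more. *)
Lemma card_above r k a : a \in alive e (r + k) -> (k <= #|above (alive e r) a|)%N.
Proof.
elim: k a => // k IHk a; rewrite addnS aliveS => /andP[_ /exists_inP[j jr aj]].
apply: leq_ltn_trans (IHk _ jr) _; apply/proper_card/properP; split.
  apply/fintype.subsetP => c; rewrite !inE => /andP[-> jc]; exact: e_trans jc.
exists j; rewrite !inE ?negb_and ?e_irr ?orbT // aj andbT.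
exact: (fintype.subsetP (alive_anti r k)).
Qed.

(** An element with the fewest dominators in [A] has none, since any dominator of it would have
    strictly fewer. *)
Lemma tops_eq0 A : (tops e A == finset.set0) = (A == finset.set0).
Proof.
apply/eqP/eqP => [A0|->]; last by apply/setP => i; rewrite !inE.
apply/eqP; rewrite -[_ == _]negbK; apply/negP => /set0Pn[i iA].
have [m mA mmin] := @arg_minnP _ i (mem A) (fun i => #|above A i|) iA.
have : m \notin tops e A by rewrite A0 inE.
rewrite inE [_ \in _]mA negbK => /exists_inP[j jA mj].
have := mmin j jA; rewrite leqNgt => /negP; apply.
apply/proper_card/properP; split.
  apply/fintype.subsetP => c; rewrite !inE => /andP[-> jc]; exact: e_trans jc.
by exists j; rewrite !inE ?negb_and ?e_irr ?orbT // jA.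
Qed.

(** Rounds 0 to [r] all contain [a], so each of them has a nonempty layer. *)
Lemma alive_height r a : (r < n)%N -> a \in alive e r -> (r < height e)%N.
Proof.
move=> rn ar.
have live q : (q <= r)%N -> tops e (alive e q) != finset.set0.
  move=> qr; rewrite tops_eq0; apply/set0Pn; exists a.
  by apply: (fintype.subsetP (alive_anti q (r - q))); rewrite subnKC.
rewrite /height
  -(big_mkord xpredT (fun q => nat_of_bool (tops e (alive e q) != finset.set0))).
rewrite (@big_cat_nat _ _ _ r.+1) //= -[X in (X <= _)%N]addn0 leq_add //.
rewrite (eq_big_nat _ _ (F2 := fun=> 1%N)) ?sum_nat_const_nat ?subn0 ?muln1 //.
by move=> q /andP[_]; rewrite ltnS => /live ->.
Qed.

Lemma sum_perm_precedes {R : realType} r a b :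
  \sum_s (precedes s b e (alive e r) a)%:R <=
    n`!%:R * harm_weight #|above (alive e r) a| :> R.
Proof.
(* Inspecting [b] forces it to have minimal rank on [B]. Whether or not [b] is itself a dominator,
   [B] has at least [maxn 1 #|above _ a|] elements. *)
pose B := b |: above (alive e r) a.
rewrite ler_pdivlMr ?ltr0n ?leq_maxl //.
rewrite -natr_sum -natrM ler_nat;
  apply: leq_trans (card_perm_argmin B b (finset.setU11 b _)).
apply: leq_mul; last first.
  rewrite ssrnat.geq_max (subset_leq_card (finset.subsetUr _ _)) andbT.
  by apply/card_gt0P; exists b; exact: finset.setU11.
rewrite -big_mkcond sum1dep_card subset_leq_card //; apply/fintype.subsetP => s.
rewrite !inE => /forall_inP bmin; apply/forall_inP => c.
by rewrite !inE => /orP[/eqP->//|/andP[cA ac]]; exact: implyP (bmin c cA) ac.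
Qed.

Lemma sum_alive_weight {R : realType} a :
  \sum_(r < n | a \in alive e r) harm_weight #|above (alive e r) a| <=
    \sum_(s < height e) harm_weight s :> R.
Proof.
have [/existsP[r0 ar0]|] := boolP [exists r : 'I_n, a \in alive e r].
  (* [D] is the last round in which [a] is alive, so at least [D - r] dominators are left in round
     [r]. *)
  have [D aD Dmax] :=
    @arg_maxnP _ r0 (fun r : 'I_n => a \in alive e r) (@nat_of_ord n) ar0.
  apply: (@le_trans _ _ (\sum_(r < n | (r < D.+1)%N) harm_weight (D - r))).
    rewrite big_mkcond [leRHS]big_mkcond; apply: ler_sum => r _.
    case: ifP => [ar|_]; last by case: ifP => _; rewrite ?invr_ge0 ?ler0n.
    have rD : (r <= D)%N := Dmax r ar; rewrite ltnS rD lef_pV2 ?posrE ?ltr0n ?leq_maxl //.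
    rewrite ler_nat ssrnat.geq_max leq_maxl ssrnat.leq_max card_above ?orbT //.
    by rewrite subnKC.
  (* Read backwards, the rounds carry the weights of 0 to [D], and [D < height e] allows the sum to
     be extended. *)
  rewrite -(big_ord_widen n (fun r => harm_weight (D - r)) (ltn_ord D)).
  rewrite (reindex_inj rev_ord_inj) /=.
  under eq_bigr => r _ do rewrite subSS subKn -1?ltnS //.
  rewrite (big_ord_widen (height e)) ?(alive_height D a) //.
  by rewrite big_mkcond; apply: ler_sum => r _; case: ifP; rewrite ?invr_ge0 ?ler0n.
rewrite negb_exists => /forallP P0; rewrite big_pred0 => [|r].
  by apply: sumr_ge0 => r _; rewrite invr_ge0 ler0n.
exact/negbTE.
Qed.

Lemma sum_perm_work {R : realType} :
  \sum_s (work s e)%:R <=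
    n`!%:R * n%:R ^+ 2 * (\sum_(s < height e) harm_weight s) :> R.
Proof.
(* The sum over orders goes innermost, where it counts the orders in which [a] is compared with [b]
   in round [r]. *)
have -> : \sum_s (work s e)%:R = \sum_a \sum_(r < n | a \in alive e r)
    \sum_(b in alive e r) \sum_s (precedes s b e (alive e r) a)%:R :> R.
  under eq_bigr do rewrite natr_sum.
  rewrite exchange_big [RHS](exchange_big_dep xpredT) //=; apply: eq_bigr => r _.
  under eq_bigr do rewrite natr_sum.
  rewrite exchange_big; apply: eq_bigr => a _.
  by under eq_bigr do rewrite natr_sum; exact: exchange_big.
apply: (@le_trans _ _ (\sum_a \sum_(r < n | a \in alive e r)
    n%:R * (n`!%:R * harm_weight #|above (alive e r) a|))).
  apply: ler_sum => a _; apply: ler_sum => r _.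
  apply: (@le_trans _ _ (\sum_(b in alive e r)
      n`!%:R * harm_weight #|above (alive e r) a|)).
    by apply: ler_sum => b _; exact: sum_perm_precedes.
  rewrite sumr_const -[leLHS]mulr_natl.
  rewrite ler_wpM2r ?mulr_ge0 ?invr_ge0 ?ler0n //.
  by rewrite ler_nat -[X in (_ <= X)%N]card_ord max_card.
under eq_bigr do rewrite -!big_distrr /=.
apply: (@le_trans _ _ (\sum_(a < n)
    n%:R * (n`!%:R * \sum_(s < height e) harm_weight s))).
  by apply: ler_sum => a _; rewrite !ler_wpM2l ?ler0n // sum_alive_weight.
rewrite sumr_const card_ord -[leLHS]mulr_natl le_eqVlt; apply/orP; left.
by apply/eqP; ring.
Qed.

End strict_order.
End dominance_relation.

(** * Harmonic sums against the logarithm *)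

Lemma sum_harm_weight (R : realType) (k : nat) :
  \sum_(s < k) harm_weight s <= 3 * ln (k%:R + 1) :> R.
Proof.
elim: k => [|k IHk]; first by rewrite big_ord0 add0r ln1 mulr0.
rewrite big_ord_recr /=; apply: le_trans (lerD IHk (lexx _)) _.
have k0 : 0 <= k%:R :> R by rewrite ler0n.
have z0 : 0 < k%:R + 2 :> R by lra.
have -> : k.+1%:R + 1 = k%:R + 2 :> R by rewrite -natr1; ring.
(* With this factorisation, [ln (1 + x) <= x] shows that the right-hand side grows by at least
   [3 / (k + 2)] in this step. *)
have -> : k%:R + 1 = (k%:R + 2) * (1 + - (k%:R + 2)^-1) :> R.
  by field; lra.
have y0 : 0 < 1 + - (k%:R + 2)^-1 :> R.
  by rewrite subr_gt0 invf_lt1 //; lra.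
rewrite lnM ?posrE //.
have : ln (1 + - (k%:R + 2)^-1) <= - (k%:R + 2)^-1 :> R.
  by apply: le_ln1Dx; lra.
(* The constant 3 is forced here: [k + 2 <= 3 * maxn 1 k], with equality at [k = 1]. *)
have : harm_weight k <= 3 / (k%:R + 2) :> R.
  rewrite /harm_weight -[_^-1]mul1r ler_pdivrMr ?ltr0n ?leq_maxl //.
  rewrite mulrAC ler_pdivlMr // mul1r -natrD -natrM ler_nat.
  by case: k {IHk k0 z0 y0} => // k; rewrite (maxn_idPr _) //; lia.
lra.
Qed.

(** * From points to their dominance relation *)

Section points_and_relation.
Context {R : realType} {d n : nat}.
Implicit Types (x : 'I_n -> d.-tuple R).

Definition dominance x : {ffun 'I_n * 'I_n -> bool} :=
  [ffun p => dominated (x p.1) (x p.2)].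

(** Filtering keeps the order of the points and [enum] lists indices increasingly, so the sequences
    agree entry by entry; copies of a point are kept apart by their indices. *)
Lemma iter_peel x r :
  iter r peel [seq x i | i <- enum 'I_n] =
  [seq x i | i <- enum (alive (dominance x) r)].
Proof.
elim: r => [|r IHr] /=.
  by congr map; apply: eq_enum => i; rewrite !inE.
rewrite IHr /peel filter_map; congr map; rewrite {1}/enum_mem -filter_predI.
apply: eq_filter => i; rewrite [in RHS]/= aliveS andbC /=.
congr andb; rewrite has_map; apply/hasP/exists_inP => -[j jA ij]; exists j.
- by rewrite mem_enum in jA.
- by rewrite ffunE.
- by rewrite mem_enum.
by rewrite ffunE in ij.
Qed.

Lemma num_layers_height x :
  num_layers [seq x i | i <- enum 'I_n] = height (dominance x).
Proof.
rewrite num_layersE size_map size_enum_ord; apply: eq_bigr => r _.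
congr nat_of_bool; rewrite iter_peel /Max filter_map.
set A := alive _ r.
have -> : [seq i <- enum A |
      preim x (fun q => ~~ has (dominated q) [seq x i | i <- enum A]) i] =
    enum (tops (dominance x) A).
  rewrite {1}/enum_mem -filter_predI; apply: eq_filter => i.
  rewrite [RHS]/= !inE andbC /=; congr (_ && ~~ _).
  rewrite has_map; apply/hasP/exists_inP => -[j jA ij]; exists j.
  - by rewrite mem_enum in jA.
  - by rewrite ffunE.
  - by rewrite mem_enum.
  by rewrite ffunE in ij.
by rewrite -!size_eq0 size_map -cardE cards_eq0.
Qed.

(** In an increasing list, the entries with no smaller entry satisfying [p] are those up to and
    including the first that satisfies [p], or all of them if none does. *)
Lemma scan_bound_precedes (p : pred 'I_n) (s : seq 'I_n) :
    sorted ltn [seq val i | i <- s] ->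
  (minn (find p s).+1 (size s) <=
    \sum_(b <- s) all (fun c => p c ==> (b <= c)) s)%N.
Proof.
elim: s => // z s IHs; rewrite /= path_sortedE; last exact: ltn_trans.
rewrite all_map => /andP[/allP zs /IHs {}IHs]; rewrite big_cons /= leqnn implybT /=.
have -> : all (fun c : 'I_n => p c ==> (z <= c)%N) s.
  by apply/allP => c /zs /= zc; rewrite (ltnW zc) implybT.
case: ifP => [_|pz]; first by rewrite geq_min addSn.
rewrite minnSS add1n ltnS; apply: leq_trans IHs _.
by apply: leq_sum => b _; rewrite ?pz.
Qed.

(** The input comes in the order of the indices, hence the identity permutation. *)
Lemma peeling_comparisons_work x :
  (peeling_comparisons [seq x i | i <- enum 'I_n] <= work 1 (dominance x))%N.
Proof.
rewrite /peeling_comparisons /peeling peeling_loop_cost size_map size_enum_ord.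
apply: leq_sum => r _; rewrite iter_peel; apply: leq_trans (naive_cost _) _.
set A := alive _ r; rewrite big_map big_enum; apply: leq_sum => a _.
rewrite /scan_bound find_map size_map.
have sA : sorted ltn [seq val i | i <- enum A].
  rewrite sorted_map /enum_mem -enumT sorted_filter //.
    by move=> ? ? ?; exact: ltn_trans.
  by rewrite -sorted_map val_enum_ord iota_ltn_sorted.
apply: leq_trans (scan_bound_precedes _ _ sA) _; rewrite big_enum.
apply: leq_sum => b _; rewrite leq_eqVlt; apply/orP; left; apply/eqP.
congr nat_of_bool; apply/allP/forall_inP => + c => /(_ c).
  by rewrite mem_enum !perm1 ffunE.
by rewrite mem_enum !perm1 ffunE.
Qed.

Lemma dominance_irr x i : ~~ dominance x (i, i).
Proof. by rewrite ffunE dominated_irr. Qed.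

Lemma dominance_trans x j i k :
  dominance x (i, j) -> dominance x (j, k) -> dominance x (i, k).
Proof. by rewrite !ffunE; exact: dominated_trans. Qed.

(** The event is a finite Boolean combination of comparisons between coordinates. *)
Lemma measurable_dominance m :
  measurable [set t : n.-tuple (d.-tuple R) | dominance (tnth t) = m].
Proof.
have coord i l : measurable_fun setT (fun t : n.-tuple (d.-tuple R) => tnth (tnth t i) l).
  exact: (measurableT_comp (measurable_tnth l) (measurable_tnth i)).
have mdom p : measurable
    [set t : n.-tuple (d.-tuple R) | dominated (tnth t p.1) (tnth t p.2)].
  rewrite (_ : [set _ | _] =
    (\bigcap_(l in [set: 'I_d]) [set t | tnth (tnth t p.1) l <= tnth (tnth t p.2) l]) `&`
    (\bigcup_(l in [set: 'I_d]) [set t | tnth (tnth t p.1) l < tnth (tnth t p.2) l])).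
    apply: measurableI.
      apply: fin_bigcap_measurable => // l _.
      rewrite -[X in measurable X]setTI.
      have := measurable_fun_ler (coord p.1 l) (coord p.2 l).
      by move=> /(_ measurableT [set true] I).
    apply: fin_bigcup_measurable => // l _.
    rewrite -[X in measurable X]setTI.
    have := measurable_fun_ltr (coord p.1 l) (coord p.2 l).
    by move=> /(_ measurableT [set true] I).
  apply/seteqP; split=> t /=.
    by move=> /dominatedP[tle [l tlt]]; split=> [k _|]; [exact: tle|exists l].
  by move=> [tle [l _ tlt]]; apply/dominatedP; split=> [k|]; [exact: tle|exists l].
rewrite (_ : [set _ | _] = \bigcap_(p in [set: 'I_n * 'I_n])
    [set t | dominated (tnth t p.1) (tnth t p.2) = m p]).
  apply: fin_bigcap_measurable => // p _.
  case: (m p); first exact: mdom.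
  rewrite (_ : [set _ | _] = ~` [set t | dominated (tnth t p.1) (tnth t p.2)]).
    by apply: measurableC; exact: mdom.
  by apply/seteqP; split=> t /=; [move=> ->|move=> /negP/negbTE].
apply/seteqP; split=> t /=; first by move=> <- p _ /=; rewrite ffunE.
by move=> tm; apply/ffunP => p; rewrite ffunE; exact: tm.
Qed.

End points_and_relation.

(** * Exchangeability of independent, identically distributed variables *)

Section exchangeability.
Context {disp : measure_display} {Omega : measurableType disp} {R : realType}.
Variable P : probability Omega R.
Context {disp' : measure_display} {T : measurableType disp'} {n : nat}.

(** A generating family closed under intersection, on which independence computes the joint law. *)
Definition boxes : set (set (n.-tuple T)) :=
  [set B | exists2 A : 'I_n -> set T, (forall i, measurable (A i)) &
     B = [set t | forall i, A i (tnth t i)]].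

Lemma measurable_boxes : @measurable _ (n.-tuple T) = <<s boxes >>.
Proof.
apply/seteqP; split.
  apply: smallest_sub; first exact: smallest_sigma_algebra.
  rewrite -bigcup_seq => B [i _ [A mA <-]]; apply: sub_sigma_algebra.
  exists (fun j => if j == i then A else setT).
    by move=> j; case: ifP.
  apply/seteqP; split=> t /=; first by move=> [_ Ati] j; case: eqP => // ->.
  by move=> /(_ i); rewrite eqxx.
apply: smallest_sub; first exact: sigma_algebra_measurable.
move=> _ [A mA ->].
rewrite (_ : [set _ | _] = \bigcap_(i in [set: 'I_n]) (fun t => tnth t i) @^-1` A i).
  apply: fin_bigcap_measurable => // i _; rewrite -[X in measurable X]setTI.
  exact: measurable_tnth.
by apply/seteqP; split=> t /= At i; have := At i; [|exact].
Qed.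

Variable X : 'I_n -> {RV P >-> T}.
Hypothesis X_indep : mutually_independent X.
Hypothesis X_id : forall i j A, measurable A ->
  distribution P (X i) A = distribution P (X j) A.

Definition family (s : {perm 'I_n}) (w : Omega) : n.-tuple T :=
  [tuple X (s i) w | i < n].

Lemma measurable_family s : measurable_fun [set: Omega] (family s).
Proof.
apply/measurable_fun_tnthP => i.
rewrite (_ : _ \o _ = X (s i)); last by apply/funext => w /=; rewrite tnth_mktuple.
exact: measurable_funP.
Qed.

HB.instance Definition _ s :=
  isMeasurableFun.Build _ _ _ _ (family s) (measurable_family s).

(** Finite measures that agree on boxes are equal. On a box both laws are the same product, since
    the factors commute and the variables share one law. *)
Lemma exchangeable s B : measurable B ->
  P (family s @^-1` B) = P (family 1 @^-1` B).
Proof.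
move=> mB.
apply: (@measure_unique _ _ _ boxes (fun=> setT) measurable_boxes _ _ _
  (distribution P (family s : {RV P >-> n.-tuple T}))
  (distribution P (family 1 : {RV P >-> n.-tuple T})) _ _ B mB).
- move=> _ _ [A mA ->] [A' mA' ->]; exists (fun i => A i `&` A' i).
    by move=> i; exact: measurableI.
  apply/seteqP; split=> t /=; first by move=> [At A't] i; split.
  by move=> H; split=> i; have [] := H i.
- move=> _; exists (fun=> setT) => //.
  by apply/seteqP; split.
- by rewrite bigcup_const.
- move=> _ [A mA ->].
  have law s' : P (family s' @^-1` [set t | forall i, A i (tnth t i)]) =
      (\prod_i P (X i @^-1` A i))%E.
    (* Coordinate [i] of [family s'] is [X (s' i)], so the side constraining [X j] is the one of
       index [s'^-1 j]. *)
    have := X_indep [set: 'I_n]%SET (fun j => A (s'^-1%g j)) (fun j => mA _).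
    rewrite (_ : \bigcap_(i in _) _ = family s' @^-1` [set t | forall i, A i (tnth t i)]).
      move=> ->; rewrite (eq_bigl xpredT) => [|i]; last by rewrite inE.
      rewrite (reindex_inj (@perm_inj _ s')); apply: eq_bigr => i _.
      by rewrite permK; exact: X_id.
    apply/seteqP; split=> w /= Aw i.
      rewrite tnth_mktuple; have := Aw (s' i); rewrite permK; apply.
      by rewrite /= inE.
    by move=> _; have := Aw (s'^-1%g i); rewrite tnth_mktuple permKV.
  by transitivity (\prod_i P (X i @^-1` A i))%E; [exact: law|exact/esym/law].
- by move=> _ /=; rewrite /distribution /pushforward preimage_setT probability_setT ltry.
Qed.

End exchangeability.

(** Every simple function below [f] is below [g], so the suprema defining the integrals compare.
    This serves for [comparisons], whose measurability is not established. *)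
Lemma ge0_le_integral_nonmeasurable {disp} {T : measurableType disp}
    {R : realType} (mu : {measure set T -> \bar R}) (f g : T -> \bar R) :
    (forall x, (0 <= f x)%E) -> (forall x, (f x <= g x)%E) ->
  (\int[mu]_x f x <= \int[mu]_x g x)%E.
Proof.
move=> f0 fg; have g0 x : (0 <= g x)%E by exact: le_trans (f0 x) (fg x).
rewrite !ge0_integralTE //; apply: le_ereal_sup => _ [h hf <-].
by exists h => // x; exact: le_trans (hf x) (fg x).
Qed.

Lemma integral_finite_valued {disp} {Omega : measurableType disp} {R : realType}
    (P : probability Omega R) (I : finType) (N : Omega -> I) (F : I -> R) :
    (forall m, measurable [set w | N w = m]) -> (forall m, 0 <= F m) ->
  (\int[P]_w (F (N w))%:E = (\sum_m F m * fine (P [set w | N w = m]))%:E)%E.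
Proof.
move=> mN F0.
rewrite (_ : (fun w => _) = fun w => \sum_m ((F m)%:E * (\1_[set w | N w = m] w)%:E)%E).
  rewrite ge0_integral_sum //; first last.
  - by move=> m w _; rewrite mule_ge0 ?lee_fin.
  - move=> m; apply: measurable_funeM; apply/measurable_EFinP.
    exact: measurable_indic.
  rewrite -sumEFin; apply: eq_bigr => m _.
  have mI : measurable_fun setT (fun w => (\1_[set w | N w = m] w : R)%:E).
    by apply/measurable_EFinP; exact: measurable_indic.
  rewrite ge0_integralZl_EFin // integral_indic // setIT.
  by rewrite EFinM fineK ?fin_num_measure.
apply/funext => w; rewrite (bigD1 (N w)) //= indicE mem_set // mule1.
rewrite big1 ?adde0 // => m mN'; rewrite indicE memNset ?mule0 //=.
by move=> Nm; rewrite Nm eqxx in mN'.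
Qed.

(** * The conditional expectation, averaged over the orders of the input *)

Lemma relabelK {n} (s : {perm 'I_n}) : cancel (relabel s) (relabel s^-1).
Proof. by move=> m; apply/ffunP => -[i j]; rewrite !ffunE /= !permKV. Qed.

Theorem theorem4 (R : realType) (d : nat) (hd : (1 <= d)%N) :
  exists C : R,
  forall (disp : measure_display) (Omega : measurableType disp)
    (P : probability Omega R) (D : set (d.-tuple R)) (n : nat)
    (X : 'I_n -> {RV P >-> d.-tuple R}),
    measurable D ->
    (0 < volume D)%E -> (volume D < +oo)%E ->
    mutually_independent X ->
    (forall i : 'I_n, uniform_on D (X i)) ->
    let points (w : Omega) : seq (d.-tuple R) := [tuple X i w | i < n] in
    let K (w : Omega) : nat := num_layers (points w) in
    let comparisons (w : Omega) : R := (peeling_comparisons (points w))%:R in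
    forall k : nat,
      (0 < P [set w | K w = k])%E ->
      (cond_expectation P comparisons [set w | K w = k]
         <= (C * n%:R ^+ 2 * ln (k%:R + 1))%:E)%E.
Proof.
(* 3 is the constant of [sum_harm_weight]. *)
exists 3 => disp Omega P D n X _ _ _ X_indep X_unif points K comparisons k PK0.
pose N w := dominance (fun i => X i w).
have X_id i j A : measurable A -> distribution P (X i) A = distribution P (X j) A.
  by move=> mA; rewrite !X_unif.
have N_family s w : dominance (tnth (family P X s w)) = relabel s (N w).
  by apply/ffunP => -[i j]; rewrite !ffunE /= !tnth_mktuple.
have N_preimage s m : [set w | relabel s (N w) = m] =
    family P X s @^-1` [set t | dominance (tnth t) = m].
  by apply/seteqP; split=> w /=; rewrite N_family.
have relabel1 m : relabel 1 m = m :> {ffun 'I_n * 'I_n -> bool}.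
  by apply/ffunP => -[i j]; rewrite ffunE /= !perm1.
have N1 m : [set w | N w = m] = family P X 1 @^-1` [set t | dominance (tnth t) = m].
  by rewrite -N_preimage; apply/seteqP; split=> w /=; rewrite relabel1.
have mN m : measurable [set w | N w = m].
  rewrite N1 -[X in measurable X]setTI; apply: measurable_family => //.
  exact: measurable_dominance.
pose pr (m : {ffun 'I_n * 'I_n -> bool}) := fine (P [set w | N w = m]).
(* By exchangeability [N] and [relabel s N] have the same law, and [relabel s] is injective. *)
have pr_relabel s m : pr (relabel s m) = pr m.
  rewrite /pr N1 -(exchangeable P X X_indep X_id s); last exact: measurable_dominance.
  rewrite -N_preimage; congr (fine (P _)); apply/seteqP; split=> w /= [].
    exact: (can_inj (relabelK s)).
  by move=> ->.
have pr_ge0 m : 0 <= pr m by rewrite fine_ge0.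
have points_map w : points w = [seq X i w | i <- enum 'I_n] by [].
have KE w : K w = height (N w) by rewrite /K points_map num_layers_height.
set E := [set w | K w = k] in PK0 *.
pose H (m : {ffun 'I_n * 'I_n -> bool}) : R := (height m == k)%:R.
have PE : P E = (\sum_m H m * pr m)%:E.
  rewrite -(integral_finite_valued P _ N H) // /H.
  have mE : measurable E.
    rewrite (_ : E = \bigcup_(m in [set m | height m = k]) [set w | N w = m]).
      exact: fin_bigcup_measurable.
    by apply/seteqP; split=> w; rewrite /E /bigcup /= KE;
      [exists (N w)|move=> [m <- ->]].
  rewrite -[E]setIT -(integral_indic P measurableT mE); apply: eq_integral => w _.
  rewrite indicE -KE; congr (_%:R%:E); congr nat_of_bool.
  by apply/idP/eqP => [/set_mem//|/mem_set].
rewrite /cond_expectation PE in PK0 *.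
rewrite lte_fin in PK0; rewrite inver gt_eqF // lee_pdivrMr // -EFinM.
rewrite integral_mkcond.
(* The bound [work 1] on the cost, restricted to [K = k], depends on the relation alone, so its
   integral is a finite sum. *)
pose F (m : {ffun 'I_n * 'I_n -> bool}) : R := H m * (work 1 m)%:R.
apply: (@le_trans _ _ (\int[P]_w (F (N w))%:E)%E).
  apply: ge0_le_integral_nonmeasurable => w.
    by apply: erestrict_ge0 => w' _; rewrite lee_fin.
  rewrite patchE /F /H -KE; case: ifPn => [/set_mem /= ->|_].
    rewrite eqxx mul1r lee_fin ler_nat /N points_map.
    exact: peeling_comparisons_work.
  by rewrite lee_fin mulr_ge0.
rewrite integral_finite_valued //; last by move=> m; rewrite mulr_ge0.
(* Substituting [relabel s^-1 m] for [m] preserves height and probability and turns the work in the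
   given order into the work in the order [s]. *)
have sym s : \sum_m F m * pr m = \sum_m H m * (work s m)%:R * pr m.
  rewrite (reindex_inj (can_inj (relabelK s^-1))); apply: eq_bigr => m _.
  by rewrite /F /H height_relabel pr_relabel work_relabel invgK.
rewrite lee_fin -(@ler_pM2l _ n`!%:R) ?ltr0n ?fact_gt0 //.
have -> : n`!%:R * \sum_m F m * pr m =
    \sum_m H m * (\sum_(s : {perm 'I_n}) (work s m)%:R) * pr m.
  transitivity (\sum_(s : {perm 'I_n}) \sum_m F m * pr m).
    by rewrite sumr_const card_Sn mulr_natl.
  rewrite (eq_bigr _ (fun s _ => sym s)) exchange_big; apply: eq_bigr => m _.
  by rewrite big_distrr big_distrl.
rewrite mulrA big_distrr /=; apply: ler_sum => m _.
(* A relation of nonzero probability is realised by actual points, hence irreflexive and transitive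
   as [sum_perm_work] requires. *)
rewrite [leRHS]mulrA; have [prm0|] := eqVneq (pr m) 0; first by rewrite prm0 !mulr0.
have [Nm0|/set0P[w /= <-] _] := eqVneq [set w | N w = m] set0.
  by rewrite /pr Nm0 measure0 eqxx.
rewrite ler_wpM2r // mulrC /H; case: eqP => [hk|_]; last by rewrite !mulr0.
rewrite !mulr1 -hk.
apply: le_trans (sum_perm_work _ (dominance_irr _) (dominance_trans _)) _.
rewrite [3 * _]mulrC -!mulrA !ler_wpM2l ?ler0n ?exprn_ge0 //.
exact: sum_harm_weight.
Qed.
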